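(* For $3\le D\le 20000$ there is no graph of degree $11$, diameter $D$ and cyclic defect. Furthermore, for odd $g$ with $7\le g\le 40001$ there is no graph of degree $11$, girth $g$ and cyclic excess.
   Context: For an integer $d\ge 1$ define polynomials $G_{d,m}(x)$ by $G_{d,0}(x)=1$, $G_{d,1}(x)=x+1$, and $G_{d,m+1}(x)=xG_{d,m}(x)-(d-1)G_{d,m-1}(x)$ for $m\ge1$. Let $J_n$ be the $n\times n$ all-ones matrix. For a graph on $n\ge3$ vertices, a cycle matrix is the adjacency matrix $B$ of an $n$-cycle on the same vertex set (i.e., for some ordering $v_1,\dots,v_n$ of the vertices, $B_{ij}=1$ iff $v_i,v_j$ are cyclically consecutive, and $0$ otherwise); this cycle need not consist of edges of the graph. A graph $\Gamma$ of order $n$ with adjacency matrix $A$ is a graph of degree $d$, diameter $D$ and cyclic defect if $\Gamma$ is $d$-regular with $d\ge3$, has diameter $D\ge2$, and $G_{d,D}(A)=J_n+B$ for some cycle matrix $B$. It is a graph of degree $d$, girth $g$ and cyclic excess if $\Gamma$ is $d$-regular with $d\ge3$, has odd girth $g\ge5$, and $G_{d,\lfloor g/2\rfloor}(A)=J_n-B$ for some cycle matrix $B$. *)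

(* Defs.v *)
From mathcomp Require Import all_boot all_order all_fingroup all_algebra.

Set Implicit Arguments.
Unset Strict Implicit.
Unset Printing Implicit Defensive.

Import GRing.Theory.
Local Open Scope ring_scope.

Fixpoint Gpoly (d m : nat) {struct m} : {poly int} :=
  match m with
  | 0 => 1
  | m1.+1 => match m1 with
             | 0 => 'X + 1
             | m2.+1 => 'X * Gpoly d m1 - (d%:R - 1) *: Gpoly d m2
             end
  end.

(* [horner_mx] is only available for matrices of size n.+1, whereas the order
   of a graph is #|T|; [mx_evalE] shows that the two evaluations agree. *)
Definition mx_eval (R : comNzRingType) (n : nat) (p : {poly R}) (A : 'M[R]_n) :
  'M[R]_n := \sum_(k < size p) p`_k *: A ^+ k.

Lemma mx_evalE (R : comNzRingType) (n : nat) (p : {poly R}) (A : 'M[R]_n.+1) :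
  mx_eval p A = horner_mx A p.
Proof.
rewrite /mx_eval [in RHS](_ : p = \sum_(k < size p) p`_k *: 'X^k).
  rewrite linear_sum; apply: eq_bigr => k _.
  by rewrite linearZ /= rmorphXn /= horner_mx_X.
by rewrite -poly_def coefK.
Qed.

Section Graphs.

Variable T : finType.
Implicit Type e : rel T.

Definition simple_graph e := symmetric e /\ irreflexive e.

Definition regular e (d : nat) := forall x : T, #|[set y | e x y]| = d.

Definition adj_mx e : 'M[int]_#|T| :=
  \matrix_(i, j) (e (enum_val i) (enum_val j))%:R.

Definition walk e (x y : T) (k : nat) :=
  exists p : seq T, [/\ path e x p, last x p = y & size p = k].

Definition has_dist e (x y : T) (k : nat) :=
  walk e x y k /\ forall l, walk e x y l -> (k <= l)%N.

(* In particular the graph is connected: every pair has a distance. *)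
Definition has_diameter e (D : nat) :=
  (forall x y, exists2 k, has_dist e x y k & (k <= D)%N) /\
  (exists x y, has_dist e x y D).

(* The bound on the size excludes the empty cycle and the closed walks
   x, y, x, which [ucycle] accepts. *)
Definition graph_cycle e (c : seq T) := ucycle e c /\ (2 < size c)%N.

Definition has_girth e (g : nat) :=
  (exists2 c, graph_cycle e c & size c = g) /\
  (forall c, graph_cycle e c -> (g <= size c)%N).

End Graphs.

(* s is the ordering of the vertices along the cycle; [ordS] is the cyclic
   successor i |-> i + 1 mod n. *)
Definition cycle_mx (n : nat) (B : 'M[int]_n) :=
  (2 < n)%N /\
  exists s : 'S_n, forall i j : 'I_n,
    B (s i) (s j) = ((j == ordS i) || (i == ordS j))%:R.

Definition cyclic_defect_graph (T : finType) (e : rel T) (d D : nat) :=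
  [/\ simple_graph e, (3 <= d)%N /\ regular e d,
      (2 <= D)%N /\ has_diameter e D &
      exists2 B : 'M[int]_#|T|, cycle_mx B &
        mx_eval (Gpoly d D) (adj_mx e) = const_mx 1 + B].

Definition cyclic_excess_graph (T : finType) (e : rel T) (d g : nat) :=
  [/\ simple_graph e, (3 <= d)%N /\ regular e d,
      [/\ odd g, (5 <= g)%N & has_girth e g] &
      exists2 B : 'M[int]_#|T|, cycle_mx B &
        mx_eval (Gpoly d g./2) (adj_mx e) = const_mx 1 - B].

(* Main.v *)
Require Import Defs.
From mathcomp Require Import all_boot all_order all_fingroup all_algebra.
From mathcomp Require Import zify ring.

(** In degree 11 the order [n] is even, so the alternating [+1/-1] vector along
    the cycle of [B] spans the eigenspace of [B] for the eigenvalue [-2]. Since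
    [A] commutes with [J] and with [G(A) = J +/- B], it commutes with [B], so this
    vector is an eigenvector of [A], with an integer eigenvalue [l] such that
    [|l| <= 11] and [G(l) = -/+ 2]. For each of the 23 candidates [l], the
    recurrence for [G_{11,m}(l)] modulo a suitable small number never takes the
    value [-2] (resp. [2]) at an index [m >= 3]. *)

Set Implicit Arguments.
Unset Strict Implicit.
Unset Printing Implicit Defensive.

Import Order.TTheory GRing.Theory Num.Theory.
Local Open Scope ring_scope.

(** * Polynomials evaluated at a matrix *)

Lemma mx_eval_comm (R : comNzRingType) (n : nat) (p : {poly R}) (A : 'M[R]_n) :
  A *m mx_eval p A = mx_eval p A *m A.
Proof.
rewrite /mx_eval mulmx_sumr mulmx_suml; apply: eq_bigr => k _.
rewrite -scalemxAr -scalemxAl; congr (_ *: _).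
exact: (commrX k (erefl (A * A))).
Qed.

Lemma mx_eval_eigen (R : comNzRingType) (n : nat) (p : {poly R}) (A : 'M[R]_n)
    (v : 'cV[R]_n) (l : R) :
  A *m v = l *: v -> mx_eval p A *m v = p.[l] *: v.
Proof.
move=> Av; have Akv k : (A ^+ k) *m v = l ^+ k *: v.
  elim: k => [|k IHk]; first by rewrite !expr0 mul1mx scale1r.
  by rewrite exprS -mulmxA IHk -scalemxAr Av scalerA exprSr.
rewrite /mx_eval mulmx_suml horner_coef scaler_suml.
by apply: eq_bigr => k _; rewrite -scalemxAl Akv scalerA.
Qed.

(** * Cycle matrices and their eigenvalue -2 *)

Lemma ordS_invariant (T : Type) (n : nat) (f : 'I_n -> T) :
  (forall i, f (ordS i) = f i) -> forall i j, f i = f j.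
Proof.
move=> fS i j; have n_gt0 : (0 < n)%N by apply: leq_ltn_trans (ltn_ord i).
suff f0 k : f k = f (Ordinal n_gt0) by rewrite !f0.
case: k; elim=> [|k IHk] lt_k_n; first by congr f; apply: val_inj.
rewrite -(IHk (ltnW lt_k_n)) -[RHS]fS; congr f; apply: val_inj => /=.
by rewrite modn_small.
Qed.

Lemma ordS_neq_pred (n : nat) (i : 'I_n) : (2 < n)%N -> ordS i != ord_pred i.
Proof.
move=> n_gt2; apply/eqP => /(congr1 (fun k => nat_of_ord (ordS k))).
rewrite ord_predK /=; have lt_i_n := ltn_ord i.
have [lt_Si|le_Si] := ltnP i.+1 n; last first.
  by have -> : i.+1 = n; [lia | rewrite modnn modn_small; lia].
rewrite (modn_small lt_Si); have [lt_SSi|le_SSi] := ltnP i.+2 n.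
  by rewrite modn_small; lia.
by have -> : i.+2 = n; [lia | rewrite modnn; lia].
Qed.

Lemma cycle_mx_mulE (n : nat) (B : 'M[int]_n) (s : 'S_n) (w : 'cV[int]_n) :
  (2 < n)%N ->
  (forall i j, B (s i) (s j) = ((j == ordS i) || (i == ordS j))%:R) ->
  forall i, (B *m w) (s i) 0 = w (s (ordS i)) 0 + w (s (ord_pred i)) 0.
Proof.
move=> n_gt2 Bs i; rewrite mxE (reindex_inj (@perm_inj _ s)) /=.
rewrite (bigD1 (ordS i)) //= (bigD1 (ord_pred i)) /=; last first.
  by rewrite eq_sym ordS_neq_pred.
rewrite !Bs eqxx ord_predK eqxx orbT !mul1r big1 ?addr0 // => j.
case/andP=> /negPf jS /negPf jP; rewrite Bs jS /=.
case: eqP => [iS|_]; last by rewrite mul0r.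
by rewrite iS ordSK eqxx in jP.
Qed.

(** Reduction modulo an even [n] preserves parity, so the signs still alternate at the wrap-around
    from [n - 1] to 0. *)
Lemma signr_ordS (n : nat) (i : 'I_n) :
  ~~ odd n -> (-1) ^+ (ordS i) = - (-1) ^+ i :> int.
Proof.
move=> n_even; rewrite -signr_odd -(signr_odd _ i).
suff -> : odd (ordS i) = ~~ odd i by case: (odd i); rewrite ?expr1 ?opprK.
have /(congr1 odd) := divn_eq i.+1 n.
by rewrite oddD oddM (negPf n_even) andbF /= => <-.
Qed.

(** Multiplying [w] by the alternating sign turns the eigenvalue equation into the vanishing of
    second differences around the cycle. *)
Lemma cycle_mx_eigenspace (n : nat) (B : 'M[int]_n) (s : 'S_n) (w : 'cV[int]_n) :
  (2 < n)%N -> ~~ odd n ->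
  (forall i j, B (s i) (s j) = ((j == ordS i) || (i == ordS j))%:R) ->
  B *m w = (-2) *: w ->
  exists l, forall i, w (s i) 0 = l * (-1) ^+ i.
Proof.
move=> n_gt2 n_even Bs Bw; have n_gt0 : (0 < n)%N by lia.
pose u (i : 'I_n) := (-1) ^+ i * w (s i) 0.
have uE i : w (s i) 0 = (-1) ^+ i * u i by rewrite /u signrMK.
have usum i : u (ordS (ordS i)) + u i = 2 * u (ordS i).
  have := cycle_mx_mulE w n_gt2 Bs (ordS i).
  rewrite ordSK Bw mxE !uE !signr_ordS // opprK.
  have : (-1) ^+ i * (-1) ^+ i = 1 :> int by rewrite -expr2 sqrr_sign.
  set e := (-1) ^+ i => ee /(congr1 ( *%R e)).
  have -> : e * (-2 * (- e * u (ordS i))) = (e * e) * (2 * u (ordS i)) by ring.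
  by rewrite mulrDr !(mulrA e e) ee !mul1r => <-.
pose delta i := u (ordS i) - u i.
have deltaC : forall i j, delta i = delta j.
  by apply: ordS_invariant => i; rewrite /delta; have := usum i; lia.
(* The constant first difference telescopes to 0 around the cycle, so it vanishes. *)
have delta0 i : delta i = 0.
  have : \sum_j delta j = 0.
    rewrite /delta sumrB [X in _ - X](reindex_inj (can_inj (@ordSK n))) /=.
    by rewrite subrr.
  rewrite (eq_bigr (fun=> delta i)) => [|j _]; last exact: deltaC.
  rewrite sumr_const card_ord => /eqP; rewrite mulrn_eq0.
  by case/orP=> [/eqP n0|/eqP //]; lia.
have uC : forall i j, u i = u j.
  by apply: ordS_invariant => i; apply/eqP; rewrite -subr_eq0; apply/eqP/delta0.
exists (u (Ordinal n_gt0)) => i.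
by rewrite uE mulrC (uC i (Ordinal n_gt0)).
Qed.

(** Treats defect ([c = 1]) and excess ([c = -1]) together. *)
Lemma cycle_mx_eigenvalue (n : nat) (A B : 'M[int]_n) (p : {poly int}) (c d : int) :
  c != 0 -> (forall i j, 0 <= A i j) ->
  (forall i, \sum_j A i j = d) -> (forall j, \sum_i A i j = d) ->
  cycle_mx B -> mx_eval p A = const_mx 1 + c *: B -> (2 %| p.[d])%Z ->
  exists2 l : int, `|l| <= d & p.[l] = - 2 * c.
Proof.
move=> c0 A_ge0 rowA colA [n_gt2 [s Bs]] pA pd_even.
have n_gt0 : (0 < n)%N by lia.
pose i0 := Ordinal n_gt0.
have BE := cycle_mx_mulE _ n_gt2 Bs.
(* The all-ones vector has eigenvalue [d] for [A] and 2 for [B], whence [p.[d] = n + 2 * c]. *)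
have n_even : ~~ odd n.
  pose u : 'cV[int]_n := const_mx 1.
  have Au : A *m u = d *: u.
    apply/colP => i; rewrite !mxE mulr1 -[RHS](rowA i).
    by apply: eq_bigr => j _; rewrite mxE mulr1.
  have := mx_eval_eigen p Au; rewrite pA mulmxDl -scalemxAl.
  move/matrixP/(_ (s i0) 0); rewrite mxE [X in _ + X]mxE BE !mxE.
  rewrite (eq_bigr (fun=> 1)) => [|j _]; last by rewrite !mxE mulr1.
  rewrite sumr_const card_ord mulr1 => pd; move: pd_even; rewrite -pd; lia.
have AJ : A *m const_mx 1 = const_mx 1 *m A.
  apply/matrixP => i j; rewrite !mxE.
  rewrite (eq_bigr (A i)) => [|k _]; last by rewrite mxE mulr1.
  rewrite [RHS](eq_bigr (A^~ j)) => [|k _]; last by rewrite mxE mul1r.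
  by rewrite rowA colA.
have AB : A *m B = B *m A.
  have := mx_eval_comm p A; rewrite pA mulmxDl mulmxDr AJ => /addrI.
  rewrite -scalemxAr -scalemxAl => /matrixP AB; apply/matrixP => i j.
  by have := AB i j; rewrite !mxE => /(mulfI c0).
pose v : 'cV[int]_n := \col_i (-1) ^+ (s^-1%g i).
have vE i : v (s i) 0 = (-1) ^+ i by rewrite mxE permK.
have onto_s i : i = s (s^-1%g i) by rewrite permKV.
have signP (i : 'I_n) : (-1) ^+ (ord_pred i) = - (-1) ^+ i :> int.
  by have := signr_ordS (ord_pred i) n_even; rewrite ord_predK => ->; rewrite opprK.
have Bv : B *m v = (-2) *: v.
  apply/colP => i; rewrite (onto_s i) BE [RHS]mxE !vE signr_ordS // signP; ring.
have BAv : B *m (A *m v) = (-2) *: (A *m v).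
  by rewrite mulmxA -AB -mulmxA Bv -scalemxAr.
have [l Avl] := cycle_mx_eigenspace n_gt2 n_even Bs BAv.
have Av : A *m v = l *: v.
  by apply/colP => i; rewrite (onto_s i) Avl [RHS]mxE vE.
exists l.
  (* At [s i0] the entry of [v] is 1; all its entries are 1 or -1, so a row sum of [A] bounds
     [l]. *)
  have -> : `|l| = `|(A *m v) (s i0) 0| by rewrite Avl /= expr0 mulr1.
  rewrite mxE -(rowA (s i0)); apply: le_trans (ler_norm_sum _ _ _) _.
  apply: ler_sum => j _; rewrite normrM (ger0_norm (A_ge0 _ _)).
  by rewrite (onto_s j) vE normrX normrN1 expr1n mulr1.
have := mx_eval_eigen p Av; rewrite pA mulmxDl -scalemxAl Bv scalerA.
have -> : (const_mx 1 : 'M[int]_n) *m v = 0.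
  apply/colP => i; rewrite [LHS]mxE [RHS]mxE (reindex_inj (@perm_inj _ s)) /=.
  rewrite (eq_bigr (fun j : 'I_n => (-1) ^+ j)) => [|j _];
    last by rewrite mxE mul1r vE.
  (* A shift along the cycle negates the alternating sum. *)
  have : \sum_(j < n) (-1) ^+ j = - \sum_(j < n) (-1) ^+ j :> int.
    rewrite {1}(reindex_inj (can_inj (@ordSK n))) /= -sumrN.
    by apply: eq_bigr => j _; rewrite -signr_ordS.
  by set S := \sum_(j < n) _; lia.
rewrite add0r => /matrixP/(_ (s i0) 0).
by rewrite [LHS]mxE [RHS]mxE vE expr0 !mulr1 mulrC => <-.
Qed.

Section AdjacencyMatrix.

Variables (T : finType) (e : rel T) (d : nat).
Hypothesis e_reg : regular e d.

Lemma adj_mx_ge0 i j : 0 <= adj_mx e i j.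
Proof. by rewrite mxE ler0n. Qed.

Lemma adj_mx_row_sum i : \sum_j adj_mx e i j = d%:R.
Proof.
rewrite -(e_reg (enum_val i)) -sum1_card natr_sum [RHS]big_mkcond /=.
rewrite [RHS](reindex_onto enum_val enum_rank) /=;
  last by move=> x _; rewrite enum_rankK.
rewrite [RHS](eq_bigl xpredT) => [|j]; last by rewrite enum_valK eqxx.
by apply: eq_bigr => j _; rewrite mxE inE; case: (e _ _).
Qed.

Lemma adj_mx_col_sum j : symmetric e -> \sum_i adj_mx e i j = d%:R.
Proof.
move=> e_sym; rewrite -(adj_mx_row_sum j).
by apply: eq_bigr => i _; rewrite !mxE e_sym.
Qed.

End AdjacencyMatrix.

(** * Values of the polynomials at integers, for degree 11 *)

Lemma horner_GpolySS (d m : nat) (x : int) :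
  (Gpoly d m.+2).[x] =
  x * (Gpoly d m.+1).[x] - (d%:R - 1) * (Gpoly d m).[x].
Proof. by rewrite [Gpoly d m.+2]/= !hornerE. Qed.

(** The values start with 1, 12, and the coefficient 10 of the older term is even, so only index 0
    gives an odd value. *)
Lemma Gpoly11_even (m : nat) : (2 %| (Gpoly 11 m.+1).[11])%Z.
Proof.
elim: m => [|m IHm]; first by rewrite !hornerE.
by rewrite horner_GpolySS; apply: rpredB; [exact: dvdz_mull | exact: dvdz_mulr].
Qed.

(* A pair [(x, y)] stands for consecutive values of [Gpoly 11] at [l] modulo [N]. *)
Definition Gstep (l N : int) (z : int * int) : int * int :=
  (z.2, ((l * z.2 - 10 * z.1) %% N)%Z).

Definition Gstate (l N : int) (m : nat) : int * int :=
  iter m (Gstep l N) ((1 %% N)%Z, ((l + 1) %% N)%Z).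

Lemma GstateE (l N : int) (m : nat) :
  Gstate l N m =
  (((Gpoly 11 m).[l] %% N)%Z, ((Gpoly 11 m.+1).[l] %% N)%Z).
Proof.
elim: m => [|m IHm]; first by rewrite /Gstate /= !hornerE.
rewrite {1}/Gstate iterS -/(Gstate l N m) IHm /Gstep horner_GpolySS /=.
by congr (_, _); rewrite -modzDm modzMmr -modzNm modzMmr modzNm modzDm.
Qed.

(* The longest period that is needed is 24, for [l = c = 2] and [N = 11]. *)
Definition Gavoids (l c N : int) : bool :=
  let z := Gstate l N 3 in
  looping (Gstep l N) z 25 &&
  all (fun z => z.1 != (c %% N)%Z) (traject (Gstep l N) z 25).

(** By [looping], the orbit from index 3 on never leaves its first 25 states, so the finite check
    settles every [m >= 3]. *)
Lemma GavoidsP (l c N : int) (m : nat) :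
  (3 <= m)%N -> Gavoids l c N -> (Gpoly 11 m).[l] != c.
Proof.
move=> m_ge3 /andP[/loopingP loop /allP avoid].
have := avoid _ (loop (m - 3)%N); rewrite /Gstate -iterD subnK //.
rewrite -/(Gstate l N m) GstateE /=.
by apply: contraNneq => ->.
Qed.

(** The bound on [m] is sharp: [Gpoly 11 2] takes the value 2 at 3 and at -4. *)
Lemma Gpoly11_avoids (m : nat) (l c : int) :
  (3 <= m)%N -> `|l| <= 11 -> c \in [:: 2; -2] -> (Gpoly 11 m).[l] != c.
Proof.
move=> m_ge3 l_le11 c2.
(* For each of the 46 pairs of [l] and [c], one of these moduli works. *)
have /hasP[N _] : has (Gavoids l c) [:: 4; 5; 7; 8; 9; 11; 12; 13].
  have {l_le11} : l \in [seq k%:Z - 11 | k <- iota 0 23].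
    apply/mapP; exists (absz (l + 11)); last by lia.
    by rewrite mem_iota; lia.
  move: l; apply/allP; move: c c2; apply/allP.
  by vm_compute.
exact: GavoidsP.
Qed.

Local Close Scope ring_scope.

Theorem theorem9 :
  (forall D : nat, 3 <= D <= 20000 ->
     forall (T : finType) (e : rel T), ~ cyclic_defect_graph e 11 D) /\
  (forall g : nat, odd g -> 7 <= g <= 40001 ->
     forall (T : finType) (e : rel T), ~ cyclic_excess_graph e 11 g).
Proof.
have no_graph (T : finType) (e : rel T) (m : nat) (B : 'M[int]_#|T|) (c : int) :
    3 <= m -> simple_graph e -> regular e 11 -> cycle_mx B ->
    c \in [:: 1; -1]%R -> mx_eval (Gpoly 11 m) (adj_mx e) <> (const_mx 1 + c *: B)%R.
  move=> m_ge3 [e_sym _] e_reg B_cycle c1 GA.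
  have c0 : c != 0%R by move: c1; rewrite !inE => /orP[] /eqP->.
  have G_even : (2 %| (Gpoly 11 m).[11%:R]%R)%Z.
    by case: m m_ge3 {GA} => // m _; exact: Gpoly11_even.
  have [l l_le11] := cycle_mx_eigenvalue c0 (@adj_mx_ge0 T e)
    (adj_mx_row_sum e_reg) (fun j => adj_mx_col_sum e_reg j e_sym)
    B_cycle GA G_even.
  (* The value to be avoided is [- 2 * c], that is -2 for defect and 2 for excess. *)
  apply/eqP/Gpoly11_avoids => //.
  by move: c1; rewrite !inE => /orP[] /eqP->.
split=> [D /andP[D_ge3 _] T e [e_graph [_ e_reg] _ [B B_cycle GA]]|].
  by apply: (no_graph T e D B 1%R) => //; rewrite scale1r.
move=> g _ /andP[g_ge7 _] T e [e_graph [_ e_reg] _ [B B_cycle GA]].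
apply: (no_graph T e g./2 B (-1)%R) => //; last by rewrite scaleN1r.
(* [7./2] computes to 3. *)
exact: (half_leq g_ge7).
Qed.
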